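(* Let $a\in\mathbb{R}^{n+1}\setminus\{0\}$ and $\lambda:\mathbb{S}^n\to\mathbb{R}$, $\lambda(x)=\langle a,x\rangle$, where $\mathbb{S}^n\subset\mathbb{R}^{n+1}$ is the unit sphere with its canonical metric. Then the conformal gradient field $\sigma=\operatorname{grad}^{\mathbb{S}^n}\lambda$ is a harmonic section into $T\mathbb{S}^n$, equipped with the Kaluza-Klein metric with functions $A,B,C$, for: (1) $n=2$, $C=0$, $A(t)=B(t)+A_0$ ($A_0>0$ a constant) and $B(t)=Ke^{-t/2}$ ($K>0$); and $\sigma$ is also a harmonic map; (2) $n>2$, $C=0$, $A(t)=B(t)+A_0$ ($A_0>0$ a constant) and $B(t)=K\left[n+(n-2)|a|^2-(n-2)t\right]^{\frac{1}{n-2}}$ ($K>0$); but $\sigma$ is not a harmonic map.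
   Context: Let $(M,g)$ be a Riemannian manifold with Levi-Civita connection $\nabla$. At $(p,e)\in TM$ the space $T_{(p,e)}TM$ splits into the vertical space (kernel of $d\pi$, $\pi:TM\to M$ the projection) and the horizontal space defined by $\nabla$; each $X\in T_pM$ has a horizontal lift $X^h$ and a vertical lift $X^v$. A Kaluza-Klein metric on $TM$ is a Riemannian metric $G$ such that at $(p,e)$ $$G(X^h,Y^h)=A(|e|^2)g(X,Y),\quad G(X^h,Y^v)=0,\quad G(X^v,Y^v)=B(|e|^2)g(X,Y)+C(|e|^2)g(X,e)g(Y,e),$$ where $A,B,C$ are real functions of $|e|^2$, $A>0$, and $B,C$ are such that $G$ is positive definite. Here $A$ is not required to be constant. A vector field $\sigma$ on $M$ is viewed as a map $\sigma:(M,g)\to(TM,G)$. Its tension field $\tau(\sigma)=\operatorname{trace}\nabla d\sigma$ (computed with the Levi-Civita connections of $g$ and $G$) is decomposed as $\tau(\sigma)=[\tau^h(\sigma)]^h+[\tau^v(\sigma)]^v$ with $\tau^h(\sigma),\tau^v(\sigma)$ vector fields on $M$. $\sigma$ is a harmonic map if $\tau(\sigma)=0$, and a harmonic section if $\tau^v(\sigma)=0$. *)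

(* Defs.v *)
From HB Require Import structures.
From mathcomp Require Import all_boot all_order all_algebra.
From mathcomp Require Import all_classical all_reals all_analysis.
From mathcomp Require Import ring lra.
Set Implicit Arguments.
Unset Strict Implicit.
Unset Printing Implicit Defensive.
Import Order.TTheory GRing.Theory Num.Theory.
Import numFieldNormedType.Exports.
Local Open Scope ring_scope.

(* Riemannian geometry in coordinates.  A metric on (an open part of) R^m is
   its matrix-valued function g; points and tangent vectors are row vectors. *)

Definition inner (R : realType) (m : nat) (h : 'M[R]_m) (u v : 'rV[R]_m) : R :=
  (u *m h *m v^T) 0 0.

Definition dotv (R : realType) (m : nat) (u v : 'rV[R]_m) : R :=
  \sum_i u 0 i * v 0 i.

Definition is_inner (R : realType) (m : nat) (h : 'M[R]_m) : Prop :=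
  h^T = h /\ forall u : 'rV[R]_m, u != 0 -> 0 < inner h u u.

Definition partial (R : realType) (m : nat) (i : 'I_m) (f : 'rV[R]_m -> R)
    (x : 'rV[R]_m) : R :=
  'D_(delta_mx 0 i) f x.

(* Levi-Civita connection: nabla_(d_i) d_j = \sum_k (christoffel g k i j) d_k *)
Definition christoffel (R : realType) (m : nat) (g : 'rV[R]_m -> 'M[R]_m)
    (k i j : 'I_m) (x : 'rV[R]_m) : R :=
  2^-1 * \sum_l invmx (g x) k l *
    (partial i (fun y => g y j l) x + partial j (fun y => g y i l) x
     - partial l (fun y => g y i j) x).

Lemma christoffel_torsion_free (R : realType) (m : nat)
    (g : 'rV[R]_m -> 'M[R]_m) (k i j : 'I_m) (x : 'rV[R]_m) :
  (forall y, (g y)^T = g y) -> christoffel g k i j x = christoffel g k j i x.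
Proof.
move=> gT; rewrite /christoffel; congr (_ * _); apply: eq_bigr => l _.
congr (_ * _); rewrite [partial i _ x + _]addrC; congr (_ - partial l _ _).
by apply/funext => y; rewrite -[in LHS]gT mxE.
Qed.

Lemma christoffel_metric (R : realType) (m : nat)
    (g : 'rV[R]_m -> 'M[R]_m) (k i j : 'I_m) (x : 'rV[R]_m) :
  (forall y, (g y)^T = g y) -> g x \in unitmx ->
  partial k (fun y => g y i j) x =
    \sum_l (christoffel g l k i x * g x l j + christoffel g l k j x * g x i l).
Proof.
move=> gT gU.
have gs y p q : g y p q = g y q p by rewrite -[in LHS]gT mxE.
have lower p q r : \sum_l christoffel g l p q x * g x l r =
    2^-1 * (partial p (fun y => g y q r) x + partial q (fun y => g y p r) x
     - partial r (fun y => g y p q) x).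
  set L := fun l => partial p (fun y => g y q l) x
    + partial q (fun y => g y p l) x - partial l (fun y => g y p q) x.
  transitivity (\sum_l 2^-1 * ((g x *m invmx (g x)) r l * L l)).
    under eq_bigr do rewrite /christoffel mulr_sumr mulr_suml.
    rewrite exchange_big; apply: eq_bigr => l _; rewrite mxE mulr_suml mulr_sumr.
    by apply: eq_bigr => q' _; rewrite (gs x r q') -/(L l); ring.
  rewrite mulmxV // -mulr_sumr (bigD1 r) //= big1 ?addr0 => [|l lr].
    by rewrite mxE eqxx mul1r.
  by rewrite mxE eq_sym (negbTE lr) mul0r.
rewrite big_split /= lower.
under eq_bigr do rewrite gs.
rewrite lower.
have E p q r : partial r (fun y => g y p q) x = partial r (fun y => g y q p) x.
  by congr (partial r _ _); apply/funext => y.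
rewrite (E j i k) (E k j i) (E k i j); lra.
Qed.

(* nabla_u of the vector field with constant components y *)
Definition conn (R : realType) (m : nat) (g : 'rV[R]_m -> 'M[R]_m)
    (x u y : 'rV[R]_m) : 'rV[R]_m :=
  \row_k \sum_i \sum_j christoffel g k i j x * u 0 i * y 0 j.

(* (nabla d phi)(d_i, d_j) for phi : (R^m, g) -> (R^p, h) *)
Definition second_fundamental_form (R : realType) (m p : nat)
    (g : 'rV[R]_m -> 'M[R]_m) (h : 'rV[R]_p -> 'M[R]_p)
    (phi : 'rV[R]_m -> 'rV[R]_p) (i j : 'I_m) (x : 'rV[R]_m) : 'rV[R]_p :=
  \row_c (partial i (partial j (fun y => phi y 0 c)) x
    - \sum_k christoffel g k i j x * partial k (fun y => phi y 0 c) x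
    + \sum_d \sum_e christoffel h c d e (phi x)
        * partial i (fun y => phi y 0 d) x * partial j (fun y => phi y 0 e) x).

Definition tension (R : realType) (m p : nat)
    (g : 'rV[R]_m -> 'M[R]_m) (h : 'rV[R]_p -> 'M[R]_p)
    (phi : 'rV[R]_m -> 'rV[R]_p) (x : 'rV[R]_m) : 'rV[R]_p :=
  \sum_i \sum_j invmx (g x) i j *: second_fundamental_form g h phi i j x.

(* Tangent bundle: in the induced coordinates a point of TM is row_mx x e, with
   e a tangent vector at x, and its tangent vectors are again row_mx u v. *)

Definition hlift (R : realType) (m : nat) (g : 'rV[R]_m -> 'M[R]_m)
    (z : 'rV[R]_(m + m)) (X : 'rV[R]_m) : 'rV[R]_(m + m) :=
  row_mx X (- conn g (lsubmx z) X (rsubmx z)).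

Definition vlift (R : realType) (m : nat) (X : 'rV[R]_m) : 'rV[R]_(m + m) :=
  row_mx 0 X.

Definition hpart (R : realType) (m : nat) (w : 'rV[R]_(m + m)) : 'rV[R]_m :=
  lsubmx w.

Definition vpart (R : realType) (m : nat) (g : 'rV[R]_m -> 'M[R]_m)
    (z w : 'rV[R]_(m + m)) : 'rV[R]_m :=
  rsubmx w + conn g (lsubmx z) (lsubmx w) (rsubmx z).

Definition kaluza_klein_form (R : realType) (m : nat) (g : 'rV[R]_m -> 'M[R]_m)
    (A B C : R -> R) (z w w' : 'rV[R]_(m + m)) : R :=
  let h := g (lsubmx z) in
  let e := rsubmx z in
  let t := inner h e e in
  A t * inner h (hpart w) (hpart w')
  + B t * inner h (vpart g z w) (vpart g z w')
  + C t * inner h (vpart g z w) e * inner h (vpart g z w') e.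

Definition kaluza_klein (R : realType) (m : nat) (g : 'rV[R]_m -> 'M[R]_m)
    (A B C : R -> R) (z : 'rV[R]_(m + m)) : 'M[R]_(m + m) :=
  \matrix_(c, d) kaluza_klein_form g A B C z (delta_mx 0 c) (delta_mx 0 d).

Section KK.
Variables (R : realType) (m : nat) (g : 'rV[R]_m -> 'M[R]_m).
Variables (A B C : R -> R).

Lemma hv_decomp (z w : 'rV[R]_(m + m)) :
  w = hlift g z (hpart w) + vlift (vpart g z w).
Proof.
by rewrite /hlift /vlift /hpart /vpart add_row_mx addr0 addrCA addNr addr0 hsubmxK.
Qed.


Lemma hpart_hlift z X : hpart (hlift g z X) = X.
Proof. exact: row_mxKl. Qed.

Lemma hpart_vlift X : hpart (vlift X) = 0 :> 'rV[R]_m.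
Proof. exact: row_mxKl. Qed.

Lemma vpart_hlift z X : vpart g z (hlift g z X) = 0.
Proof. by rewrite /vpart /hlift row_mxKl row_mxKr addNr. Qed.

Lemma conn0 (x e : 'rV[R]_m) : conn g x 0 e = 0.
Proof.
apply/rowP => k; rewrite !mxE big1 // => i _; rewrite big1 // => j _.
by rewrite mxE mulr0 mul0r.
Qed.

Lemma vpart_vlift z X : vpart g z (vlift X) = X.
Proof. by rewrite /vpart /vlift row_mxKl row_mxKr conn0 addr0. Qed.

Lemma hpartD c (w w' : 'rV[R]_(m + m)) :
  hpart (c *: w + w') = c *: hpart w + hpart w'.
Proof. exact: linearP. Qed.

Lemma vpartD z c w w' : vpart g z (c *: w + w') = c *: vpart g z w + vpart g z w'.
Proof.
rewrite /vpart !linearP /= (_ : conn _ _ _ _ =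
  c *: conn g (lsubmx z) (lsubmx w) (rsubmx z) + conn g (lsubmx z) (lsubmx w') (rsubmx z)).
  by rewrite scalerDr addrACA.
apply/rowP => k; rewrite !mxE mulr_sumr -big_split; apply: eq_bigr => i _.
rewrite mulr_sumr -big_split; apply: eq_bigr => j _; rewrite !mxE /=; ring.
Qed.

Lemma innerDl (h : 'M[R]_m) c u u' v :
  inner h (c *: u + u') v = c * inner h u v + inner h u' v.
Proof. by rewrite /inner !mulmxDl -!scalemxAl !mxE. Qed.

Lemma innerDr (h : 'M[R]_m) c u v v' :
  inner h u (c *: v + v') = c * inner h u v + inner h u v'.
Proof. by rewrite /inner linearP mulmxDr -scalemxAr !mxE. Qed.

Lemma kaluza_kleinE (z w w' : 'rV[R]_(m + m)) :
  inner (kaluza_klein g A B C z) w w' = kaluza_klein_form g A B C z w w'.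
Proof.
set Q := kaluza_klein_form g A B C z.
have Ql c u u' v : Q (c *: u + u') v = c * Q u v + Q u' v.
  by rewrite /Q /kaluza_klein_form hpartD vpartD !innerDl; ring.
have Qr c u v v' : Q u (c *: v + v') = c * Q u v + Q u v'.
  by rewrite /Q /kaluza_klein_form hpartD vpartD !innerDl !innerDr; ring.
have Ql0 v : Q 0 v = 0 by have := Ql (-1) 0 0 v; rewrite scaler0 addr0 mulN1r addNr.
have Qr0 v : Q v 0 = 0 by have := Qr (-1) v 0 0; rewrite scaler0 addr0 mulN1r addNr.
have Qls (I : finType) (c : I -> R) (u : I -> 'rV[R]_(m + m)) v :
    Q (\sum_i c i *: u i) v = \sum_i c i * Q (u i) v.
  by elim/big_rec2: _ => [|i y x _ <-].
have Qrs (I : finType) (c : I -> R) (u : I -> 'rV[R]_(m + m)) v :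
    Q v (\sum_i c i *: u i) = \sum_i c i * Q v (u i).
  by elim/big_rec2: _ => [|i y x _ <-].
rewrite [in RHS](row_sum_delta w) [in RHS](row_sum_delta w') Qls /inner -mulmxA mxE.
apply: eq_bigr => i _; congr (_ * _); rewrite Qrs mxE.
by apply: eq_bigr => j _; rewrite !mxE mulrC.
Qed.

Lemma kaluza_klein_lifts (z : 'rV[R]_(m + m)) (X Y : 'rV[R]_m) :
  let G := inner (kaluza_klein g A B C z) in
  let gx := inner (g (lsubmx z)) in
  let e := rsubmx z in
  [/\ G (hlift g z X) (hlift g z Y) = A (gx e e) * gx X Y,
      G (hlift g z X) (vlift Y) = 0 &
      G (vlift X) (vlift Y) = B (gx e e) * gx X Y + C (gx e e) * gx X e * gx Y e].
Proof.
have i0l h u : inner h 0 u = 0 :> R by rewrite /inner !mul0mx mxE.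
have i0r h u : inner h u 0 = 0 :> R by rewrite /inner trmx0 mulmx0 mxE.
by split; rewrite kaluza_kleinE /kaluza_klein_form ?hpart_hlift ?hpart_vlift
  ?vpart_hlift ?vpart_vlift ?(i0l, i0r) ?(mulr0, mul0r, add0r, addr0).
Qed.

Lemma kaluza_klein_is_inner (z : 'rV[R]_(m + m)) :
  let t := inner (g (lsubmx z)) (rsubmx z) (rsubmx z) in
  is_inner (g (lsubmx z)) -> 0 < A t -> 0 < B t -> 0 <= C t ->
  is_inner (kaluza_klein g A B C z).
Proof.
move=> t [gT gpos] At Bt Ct.
have isym u v : inner (g (lsubmx z)) u v = inner (g (lsubmx z)) v u.
  have E : (v *m g (lsubmx z) *m u^T)^T = u *m g (lsubmx z) *m v^T.
    by rewrite !trmx_mul trmxK gT mulmxA.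
  by rewrite /inner -E mxE.
split=> [|w w0].
  apply/matrixP => i j; rewrite !mxE /kaluza_klein_form.
  by rewrite isym [inner _ (vpart _ _ _) (vpart _ _ _)]isym; ring.
rewrite kaluza_kleinE /kaluza_klein_form -/t.
set h := g _; set X := hpart w; set Y := vpart g z w.
have ge0 u : 0 <= inner h u u.
  have [->|/gpos/ltW//] := eqVneq u 0; by rewrite /inner !mul0mx mxE.
have C0 : 0 <= C t * inner h Y (rsubmx z) * inner h Y (rsubmx z).
  by rewrite -mulrA mulr_ge0 // -expr2 sqr_ge0.
apply: ltr_wpDr => //; have [X0|X0] := eqVneq X 0; last first.
  by apply: ltr_pwDl; [rewrite mulr_gt0 ?gpos|rewrite mulr_ge0 // ltW].
apply: ltr_wpDl; [by rewrite mulr_ge0 // ltW|].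
rewrite mulr_gt0 // gpos //; apply: contraNneq w0 => Y0.
rewrite (hv_decomp z w) -/X -/Y X0 Y0 /hlift /vlift.
by rewrite conn0 oppr0 !row_mx0 addr0.
Qed.

End KK.

(* The unit sphere of R^(n+1), with the atlas of the two stereographic
   projections from the poles (+-1, 0, .., 0). *)

(* inverse of the projection from ((-1) ^+ s, 0, .., 0) *)
Definition stereo (R : realType) (n : nat) (s : bool) (x : 'rV[R]_n) :
    'rV[R]_n.+1 :=
  (1 + dotv x x)^-1 *:
    (row_mx (((-1) ^+ s * (dotv x x - 1))%:M : 'M[R]_1) (2 *: x)
       : 'rV[R]_(1 + n)).

Definition sphere_metric (R : realType) (n : nat) (s : bool) (x : 'rV[R]_n) :
    'M[R]_n :=
  \matrix_(i, j) \sum_k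
    partial i (fun y => stereo s y 0 k) x
    * partial j (fun y => stereo s y 0 k) x.

Section Sphere.
Variables (R : realType) (n : nat).

Lemma stereo0 s (x : 'rV[R]_n) :
  stereo s x 0 0 = (1 + dotv x x)^-1 * ((-1) ^+ s * (dotv x x - 1)).
Proof.
rewrite /stereo mxE; congr (_ * _); rewrite (_ : 0 = lshift n 0 :> 'I_(1 + n)).
  by rewrite row_mxEl mxE eqxx mulr1n.
exact/val_inj.
Qed.

Lemma stereoS s (x : 'rV[R]_n) i :
  stereo s x 0 (lift 0 i) = (1 + dotv x x)^-1 * (2 * x 0 i).
Proof.
rewrite /stereo mxE; congr (_ * _); rewrite (_ : lift 0 i = rshift 1 i :> 'I_(1 + n)).
  by rewrite row_mxEr mxE.
exact/val_inj.
Qed.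

Lemma dotv_ge0 k (x : 'rV[R]_k) : 0 <= dotv x x.
Proof. by apply: sumr_ge0 => i _; rewrite -expr2 sqr_ge0. Qed.

Lemma stereo_sphere s (x : 'rV[R]_n) : dotv (stereo s x) (stereo s x) = 1.
Proof.
have N0 : 1 + dotv x x != 0 by rewrite gt_eqF // ltr_pwDl // dotv_ge0.
rewrite {1}/dotv big_ord_recl stereo0.
under eq_bigr do rewrite stereoS.
rewrite (_ : \sum_(i < n) _ = ((1 + dotv x x)^-1 * 2) ^+ 2 * dotv x x); last first.
  by rewrite /dotv mulr_sumr; apply: eq_bigr => i _; ring.
have : ((-1) ^+ s) ^+ 2 = 1 :> R by rewrite sqrr_sign.
by move: ((-1) ^+ s) => e e2; field: e2.
Qed.

Lemma stereo_cover (p : 'rV[R]_n.+1) : dotv p p = 1 -> exists s x, stereo s x = p.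
Proof.
move=> p1; pose s := 0 < p 0 0.
pose q := \row_i p 0 (lift 0 i) : 'rV[R]_n.
have pq : p 0 0 ^+ 2 + dotv q q = 1.
  rewrite -p1 /dotv big_ord_recl expr2; congr (_ + _).
  by apply: eq_bigr => i _; rewrite !mxE.
exists s, ((1 - (-1) ^+ s * p 0 0)^-1 *: q).
set e := (-1) ^+ s; have e2 : e ^+ 2 = 1 by rewrite sqrr_sign.
have D0 : 1 - e * p 0 0 != 0.
  rewrite gt_eqF // /e /s; case: (ltrP 0 (p 0 0)) => h /=.
    by rewrite expr1 mulN1r opprK ltr_pwDl // ltW.
  by rewrite expr0 mul1r ltr_pwDl // oppr_ge0.
have dq : dotv ((1 - e * p 0 0)^-1 *: q) ((1 - e * p 0 0)^-1 *: q)
   = (1 + e * p 0 0) / (1 - e * p 0 0).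
  transitivity ((1 - e * p 0 0)^-1 ^+ 2 * dotv q q).
    move: (1 - e * p 0 0)^-1 => c; rewrite /dotv mulr_sumr.
    by apply: eq_bigr => i _; rewrite mxE; ring.
  have -> : dotv q q = 1 - e ^+ 2 * p 0 0 ^+ 2 by rewrite e2 mul1r -pq addrC addKr.
  by field.
apply/rowP => j; case: (unliftP 0 j) => [k ->|->]; last first.
  rewrite stereo0 dq -/e.
  have -> : (1 + (1 + e * p 0 0) / (1 - e * p 0 0))^-1 = (1 - e * p 0 0) / 2.
    by field; rewrite D0 /=; lra.
  transitivity (e ^+ 2 * p 0 0); last by rewrite e2 mul1r.
  by field.
rewrite stereoS dq !mxE -[RHS]mul1r.
have -> : (1 + (1 + e * p 0 0) / (1 - e * p 0 0))^-1 = (1 - e * p 0 0) / 2.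
  by field; rewrite D0 /=; lra.
by field.
Qed.
Lemma is_derive_coord (x v : 'rV[R]_n) i :
  is_derive x v (fun y : 'rV[R]_n => y 0 i) (v 0 i).
Proof.
have d : differentiable (fun y : 'rV[R]_n => y 0 i) x by exact: differentiable_coord.
split; first exact: diff_derivable.
have := @derive_mx R 'rV[R]_n 1 n id x v (@derivable_id _ _ x v).
by rewrite derive_id => /matrixP /(_ 0 i); rewrite !mxE.
Qed.

Lemma is_derive_dotv (x v : 'rV[R]_n) :
  is_derive x v (fun y : 'rV[R]_n => dotv y y) (2 * dotv x v).
Proof.
have H i := is_derive_coord x v i.
rewrite (_ : (fun y => dotv y y) = \sum_(i < n) (fun y : 'rV[R]_n => y 0 i * y 0 i)); last first.
  by apply/funext => y; rewrite fct_sumE.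
apply: is_derive_eq.
rewrite /dotv mulr_sumr; apply: eq_bigr => i _.
rewrite /GRing.scale /=; ring.
Qed.

Let N (x : 'rV[R]_n) := 1 + dotv x x.
Lemma N_neq0 x : N x != 0.
Proof. by rewrite gt_eqF // ltr_pwDl // dotv_ge0. Qed.

Lemma is_derive_invN (x v : 'rV[R]_n) :
  is_derive x v (fun y => (N y)^-1) (- (N x) ^- 2 * (2 * dotv x v)).
Proof.
have Hd := is_derive_dotv x v.
have HN : is_derive x v N (2 * dotv x v).
  have := @is_deriveD R _ _ (cst (1:R)) (fun y => dotv y y) x v _ _ (is_derive_cst _ _ _) Hd.
  by rewrite add0r.
split; first by apply: derivableV; [exact: N_neq0|].
by rewrite deriveV ?N_neq0 // derive_val.
Qed.

Lemma dotv_delta (x : 'rV[R]_n) i : dotv x (delta_mx 0 i) = x 0 i.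
Proof.
rewrite /dotv (bigD1 i) //= big1 ?addr0 ?mxE ?eqxx ?mulr1 // => j ji.
by rewrite mxE (negbTE ji) andbF mulr0.
Qed.

Lemma partial_stereo0 s i (x : 'rV[R]_n) :
  partial i (fun y => stereo s y 0 0) x = (-1) ^+ s * (4 * x 0 i / N x ^+ 2).
Proof.
have Hv := is_derive_invN x (delta_mx 0 i).
rewrite /partial (_ : (fun y => _) = (fun y => (-1) ^+ s * (1 - 2 * (N y)^-1))); last first.
  apply/funext => y; rewrite stereo0 -/(N y).
  have -> : dotv y y = N y - 1 by rewrite /N; ring.
  by field; exact: N_neq0.
rewrite (_ : (fun y => _) = (-1) ^+ s \*: (cst 1 - 2 \*: (fun y => (N y)^-1))) //.
rewrite derive_val dotv_delta /GRing.scale /=.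
by field; exact: N_neq0.
Qed.

Lemma partial_stereoS s i k (x : 'rV[R]_n) :
  partial i (fun y => stereo s y 0 (lift 0 k)) x =
    2 * (i == k)%:R / N x - 4 * x 0 i * x 0 k / N x ^+ 2.
Proof.
have Hv := is_derive_invN x (delta_mx 0 i).
have Hc := is_derive_coord x (delta_mx 0 i) k.
rewrite /partial (_ : (fun y => _) = 2 \*: ((fun y => (N y)^-1) * (fun y : 'rV[R]_n => y 0 k))); last first.
  apply/funext => y; rewrite stereoS -/(N y).
  by rewrite -[RHS]/(2 * ((N y)^-1 * y 0 k)); ring.
rewrite derive_val dotv_delta mxE eqxx eq_sym /GRing.scale /=.
by field; exact: N_neq0.
Qed.

Lemma sphere_metricE s (x : 'rV[R]_n) :
  sphere_metric s x = (4 / (1 + dotv x x) ^+ 2)%:M.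
Proof.
apply/matrixP => i j; rewrite !mxE big_ord_recl !partial_stereo0.
under eq_bigr do rewrite !partial_stereoS.
rewrite -/(N x).
transitivity (16 * x 0 i * x 0 j / N x ^+ 4 + \sum_k
  (4 / N x ^+ 2 * ((i == k)%:R * (j == k)%:R)
   - 8 / N x ^+ 3 * (x 0 j * ((i == k)%:R * x 0 k) + x 0 i * ((j == k)%:R * x 0 k))
   + 16 * x 0 i * x 0 j / N x ^+ 4 * (x 0 k * x 0 k))).
  congr (_ + _); last by apply: eq_bigr => k _; field; exact: N_neq0.
  have : ((-1) ^+ s) ^+ 2 = 1 :> R by rewrite sqrr_sign.
  by move: ((-1) ^+ s) => e e2; field: e2; exact: N_neq0.
have dl (p : 'I_n) (f : 'I_n -> R) : \sum_k (p == k)%:R * f k = f p.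
  rewrite (bigD1 p) //= eqxx mul1r big1 ?addr0 // => k kp.
  by rewrite eq_sym (negbTE kp) mul0r.
rewrite big_split sumrB -!mulr_sumr big_split -!mulr_sumr !dl -/(dotv x x).
rewrite /=.
have -> : dotv x x = N x - 1 by rewrite /N; ring.
rewrite eq_sym; case: eqP => _; rewrite /= ?mulr1n ?mulr0n; field; exact: N_neq0.
Qed.

Lemma sphere_metric_is_inner s (x : 'rV[R]_n) : is_inner (sphere_metric s x).
Proof.
rewrite sphere_metricE; split=> [|u u0]; first exact: tr_scalar_mx.
rewrite /inner mul_mx_scalar -scalemxAl mxE mulr_gt0 //.
  by rewrite divr_gt0 // exprn_gt0 // ltr_pwDl // dotv_ge0.
have [i ui] : exists i, u 0 i != 0 by apply/rV0Pn.
rewrite mxE (bigD1 i) //= mxE ltr_pwDl // -?expr2 ?exprn_even_gt0 //.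
by apply: sumr_ge0 => j _; rewrite mxE -expr2 sqr_ge0.
Qed.
End Sphere.

(* A vector field is given by its components in each of the two charts. *)
Definition sphere_grad (R : realType) (n : nat) (f : 'rV[R]_n.+1 -> R)
    (s : bool) (x : 'rV[R]_n) : 'rV[R]_n :=
  \row_i \sum_j invmx (sphere_metric s x) i j * partial j (f \o stereo s) x.

Definition as_map (R : realType) (n : nat) (sigma : 'rV[R]_n -> 'rV[R]_n)
    (x : 'rV[R]_n) : 'rV[R]_(n + n) :=
  row_mx x (sigma x).

Definition sphere_tension (R : realType) (n : nat)
    (sigma : bool -> 'rV[R]_n -> 'rV[R]_n) (A B C : R -> R) (s : bool)
    (x : 'rV[R]_n) : 'rV[R]_(n + n) :=
  let g := @sphere_metric R n s in
  tension g (kaluza_klein g A B C) (as_map (sigma s)) x.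

Definition tension_h (R : realType) (n : nat)
    (sigma : bool -> 'rV[R]_n -> 'rV[R]_n) (A B C : R -> R) (s : bool)
    (x : 'rV[R]_n) : 'rV[R]_n :=
  hpart (sphere_tension sigma A B C s x).

Definition tension_v (R : realType) (n : nat)
    (sigma : bool -> 'rV[R]_n -> 'rV[R]_n) (A B C : R -> R) (s : bool)
    (x : 'rV[R]_n) : 'rV[R]_n :=
  vpart (@sphere_metric R n s) (as_map (sigma s) x)
    (sphere_tension sigma A B C s x).

(* The tension field only involves A, B, C near the values |sigma|^2, so these
   need not define a metric on the whole tangent bundle. *)

Definition harmonic_map (R : realType) (n : nat)
    (sigma : bool -> 'rV[R]_n -> 'rV[R]_n) (A B C : R -> R) : Prop :=
  forall s x, sphere_tension sigma A B C s x = 0.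

Definition harmonic_section (R : realType) (n : nat)
    (sigma : bool -> 'rV[R]_n -> 'rV[R]_n) (A B C : R -> R) : Prop :=
  forall s x, tension_v sigma A B C s x = 0.

(* Main.v *)
Require Import Defs.
From mathcomp Require Import all_boot all_order all_algebra.
From mathcomp Require Import all_classical all_reals all_analysis.
From mathcomp Require Import ring lra.
Import Order.TTheory GRing.Theory Num.Theory.
Import numFieldNormedType.Exports.
Local Open Scope ring_scope.

(* The field sigma satisfies nabla_X sigma = - lambda X and
   |sigma|^2 = |a|^2 - lambda^2.  Pairing its tension field with vertical and
   with horizontal lifts gives, for C = 0 and A, A', B, B' taken at |sigma|^2,
     B tau^v = ((2 - n) lambda^2 B' - B - n A') sigma,
     A tau^h = - lambda (2 A' + (n - 1) B) sigma.
   In both cases A' = B' and B is chosen so that the first coefficient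
   vanishes: B = - B' (n + (n - 2) lambda^2).  For n = 2 this reads 2 B' = - B
   and the second coefficient vanishes as well; for n > 2 it is a nonzero
   multiple of lambda, and lambda sigma is not identically zero. *)

(** * Directional derivatives of real functions on row vectors *)

Section Calculus.
Context {R : realType} {m : nat}.
Implicit Types (x v : 'rV[R]_m) (F G : 'rV[R]_m -> R).

Lemma is_derive_addf {x v F G a b} :
  is_derive x v F a -> is_derive x v G b ->
  is_derive x v (fun y => F y + G y) (a + b).
Proof. by move=> Fa Gb; exact: is_deriveD. Qed.

Lemma is_derive_mulf {x v F G a b} :
  is_derive x v F a -> is_derive x v G b ->
  is_derive x v (fun y => F y * G y) (a * G x + F x * b).
Proof.
move=> Fa Gb; rewrite (_ : (fun y => _) = F * G) //; apply: is_derive_eq.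
by rewrite /GRing.scale /= addrC [G x * a]mulrC.
Qed.

Lemma is_derive_scalef k {x v F a} :
  is_derive x v F a -> is_derive x v (fun y => k * F y) (k * a).
Proof. by move=> Fa; exact: is_deriveZ. Qed.

Lemma is_derive_sumf k x v (F : 'I_k -> 'rV[R]_m -> R) (a : 'I_k -> R) :
  (forall i, is_derive x v (F i) (a i)) ->
  is_derive x v (fun y => \sum_i F i y) (\sum_i a i).
Proof.
move=> H; rewrite (_ : (fun y => _) = \sum_i F i); first exact: is_derive_sum.
by apply/funext => y; rewrite fct_sumE.
Qed.

(** The two difference quotients coincide as functions of [h]. A directional derivative thus becomes
    a one-variable one, to which the chain rule for real functions applies. *)
Lemma is_derive_line x v F a :
  is_derive x v F a <-> is_derive (0 : R) 1 (fun h : R => F (h *: v + x)) a.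
Proof.
have E : (fun h : R => h^-1 *: ((F \o shift x) (h *: v) - F x)) =
    (fun h : R => h^-1 *: (((fun h : R => F (h *: v + x)) \o shift 0) (h *: 1)
       - (fun h : R => F (h *: v + x)) 0)).
  by apply/funext => h; rewrite /= scale0r add0r addr0 [h%:A]mulr1.
by split=> -[]; rewrite /derivable /derive => H1 H2; split;
  rewrite /derivable /derive ?E // -?E.
Qed.

Lemma is_derive_compf {x v F} {A : R -> R} {a b} :
  is_derive (F x) 1 A b -> is_derive x v F a ->
  is_derive x v (fun y => A (F y)) (b * a).
Proof.
move=> Ab /is_derive_line Fa; apply/is_derive_line.
have := @is_derive1_comp _ A (fun h : R => F (h *: v + x)) 0 b a.
by rewrite scale0r add0r; apply.
Qed.

Lemma is_derive_invf {x v F a} :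
  F x != 0 -> is_derive x v F a ->
  is_derive x v (fun y => (F y)^-1) (- a / F x ^+ 2).
Proof.
move=> F0 Fa.
have H : is_derive (F x) 1 (fun t : R => t^-1) (- (F x) ^- 2 *: 1).
  exact: (@is_deriveV _ id).
have := is_derive_compf H Fa.
by move=> H'; apply: is_derive_eq; rewrite /GRing.scale /= mulr1 mulNr mulrC mulNr.
Qed.

Lemma is_derive_dotvf {k x v} {X Y : 'rV[R]_m -> 'rV[R]_k} {X' Y' : 'rV[R]_k} :
  (forall i, is_derive x v (fun y => X y 0 i) (X' 0 i)) ->
  (forall i, is_derive x v (fun y => Y y 0 i) (Y' 0 i)) ->
  is_derive x v (fun y => dotv (X y) (Y y)) (dotv X' (Y x) + dotv (X x) Y').
Proof.
move=> HX HY; rewrite /dotv -big_split /=.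
by apply: is_derive_sumf => i; exact: is_derive_mulf.
Qed.

Lemma partialE i F a x : is_derive x (delta_mx 0 i) F a -> partial i F x = a.
Proof. by move=> H; rewrite /partial derive_val. Qed.

End Calculus.

(** * Bilinear algebra of the Euclidean product *)

Section Dotv.
Context {R : realType} {m : nat}.
Implicit Types u v w : 'rV[R]_m.

Lemma dotvC u v : dotv u v = dotv v u.
Proof. by apply: eq_bigr => i _; rewrite mulrC. Qed.

Lemma dotvDl u v w : dotv (u + v) w = dotv u w + dotv v w.
Proof. by rewrite /dotv -big_split; apply: eq_bigr => i _; rewrite mxE mulrDl. Qed.

Lemma dotvDr u v w : dotv u (v + w) = dotv u v + dotv u w.
Proof. by rewrite dotvC dotvDl !(dotvC u). Qed.

Lemma dotvZl k u v : dotv (k *: u) v = k * dotv u v.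
Proof. by rewrite /dotv mulr_sumr; apply: eq_bigr => i _; rewrite mxE mulrA. Qed.

Lemma dotvZr k u v : dotv u (k *: v) = k * dotv u v.
Proof. by rewrite dotvC dotvZl dotvC. Qed.

Lemma dotvNl u v : dotv (- u) v = - dotv u v.
Proof. by rewrite -scaleN1r dotvZl mulN1r. Qed.

Lemma dotvNr u v : dotv u (- v) = - dotv u v.
Proof. by rewrite dotvC dotvNl dotvC. Qed.

Lemma dotv_deltal i u : dotv (delta_mx 0 i) u = u 0 i.
Proof. by rewrite dotvC dotv_delta. Qed.

Lemma dotv0r u : dotv u 0 = 0.
Proof. by rewrite -(scale0r 0) dotvZr mul0r. Qed.

Lemma dotv0l u : dotv 0 u = 0.
Proof. by rewrite dotvC dotv0r. Qed.

Lemma dotv_eq0 u : dotv u u = 0 -> u = 0.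
Proof.
move=> H; apply/rowP => i; rewrite mxE.
have /eqP := @psumr_eq0P R _ xpredT (fun i => u 0 i * u 0 i)
  (fun i _ => sqr_ge0 (u 0 i)) H i isT.
by rewrite mulf_eq0 orbb => /eqP.
Qed.

Lemma dotv_gt0 u : u != 0 -> 0 < dotv u u.
Proof.
by move=> u0; rewrite lt_neqAle dotv_ge0 andbT eq_sym; apply: contra_neq u0 => /dotv_eq0.
Qed.

Lemma inner_scalar_mx k u v : inner k%:M u v = k * dotv u v.
Proof.
rewrite /inner mul_mx_scalar -scalemxAl mxE; congr (_ * _).
by rewrite mxE; apply: eq_bigr => i _; rewrite mxE.
Qed.

Lemma innerE (h : 'M[R]_m) u v :
  inner h u v = \sum_i \sum_j u 0 i * v 0 j * h i j.
Proof.
rewrite /inner mxE exchange_big; apply: eq_bigr => j _ /=.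
rewrite !mxE mulr_suml; apply: eq_bigr => i _; ring.
Qed.
End Dotv.

Definition bidotvE := (@dotvDl, @dotvDr, @dotvZl, @dotvZr, @dotvNl, @dotvNr).

(* Lowering the index of the tension field removes the inverse of the target metric. *)
Section Lowering.
Context {R : realType} {m p : nat}.

Definition trilinear (D : 'rV[R]_p -> 'rV[R]_p -> 'rV[R]_p -> R) :=
  [/\ forall k w w' u v, D (k *: w + w') u v = k * D w u v + D w' u v,
      forall k w u u' v, D w (k *: u + u') v = k * D w u v + D w u' v &
      forall k w u v v', D w u (k *: v + v') = k * D w u v + D w u v'].

Lemma linear_form_sum (L : 'rV[R]_p -> R) (u : 'rV[R]_p) :
  (forall k v v', L (k *: v + v') = k * L v + L v') ->
  L u = \sum_i u 0 i * L (delta_mx 0 i).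
Proof.
move=> LD; have L0 : L 0 = 0.
  by have := LD (-1) 0 0; rewrite scaler0 addr0 mulN1r addNr.
rewrite {1}(row_sum_delta u); elim/big_rec2: _ => [//|i y z _ <-]; exact: LD.
Qed.

Lemma trilinear_sum D w u v : trilinear D ->
  D w u v = \sum_i \sum_j \sum_k
    w 0 i * u 0 j * v 0 k * D (delta_mx 0 i) (delta_mx 0 j) (delta_mx 0 k).
Proof.
move=> [D1 D2 D3]; rewrite (linear_form_sum (fun w => D w u v)) //.
apply: eq_bigr => i _; rewrite (linear_form_sum (fun u => D _ u v)) // mulr_sumr.
apply: eq_bigr => j _; rewrite (linear_form_sum (D _ _)) // !mulr_sumr.
by apply: eq_bigr => k _; rewrite !mulrA.
Qed.

Lemma christoffel_lower (h : 'rV[R]_p -> 'M[R]_p) z q r d :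
  (forall y, (h y)^T = h y) -> h z \in unitmx ->
  \sum_l christoffel h l q r z * h z l d =
    2^-1 * (partial q (fun y => h y r d) z + partial r (fun y => h y q d) z
            - partial d (fun y => h y q r) z).
Proof.
move=> hT hU.
rewrite -[RHS]mul1r; transitivity (\sum_l (2^-1 * ((h z *m invmx (h z)) d l *
    (partial q (fun y => h y r l) z + partial r (fun y => h y q l) z
            - partial l (fun y => h y q r) z)))).
  under eq_bigr do rewrite /christoffel mulr_sumr mulr_suml.
  rewrite exchange_big; apply: eq_bigr => l _; rewrite mxE mulr_suml mulr_sumr.
  by apply: eq_bigr => k _; rewrite -[in h z k d]hT mxE; ring.
rewrite mulmxV // (bigD1 d) //= big1 ?addr0 => [|l ld].
  by rewrite mxE eqxx /= !mul1r.
by rewrite mxE eq_sym (negbTE ld) mul0r mulr0.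
Qed.

(** Here [D w u v] plays the derivative along [w] of the target metric on [u] and [v]. Since the
    inverse domain metric is [r%:M], the trace involves only diagonal pairs, and on these two of the
    three terms of the lowered Christoffel symbol agree: this leaves [D (dphi i) (dphi i) W] with
    weight one and [D W (dphi i) (dphi i)] with weight minus one half. *)
Lemma tension_lower (g : 'rV[R]_m -> 'M[R]_m) (h : 'rV[R]_p -> 'M[R]_p)
    (phi : 'rV[R]_m -> 'rV[R]_p) (x : 'rV[R]_m) (r : R)
    (D : 'rV[R]_p -> 'rV[R]_p -> 'rV[R]_p -> R)
    (dphi ddphi : 'I_m -> 'rV[R]_p) (W : 'rV[R]_p) :
  (forall y, (h y)^T = h y) -> h (phi x) \in unitmx ->
  invmx (g x) = r%:M -> trilinear D ->
  (forall i j k, partial i (fun z => h z j k) (phi x) =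
     D (delta_mx 0 i) (delta_mx 0 j) (delta_mx 0 k)) ->
  (forall i c, partial i (fun y => phi y 0 c) x = dphi i 0 c) ->
  (forall i c, partial i (partial i (fun y => phi y 0 c)) x = ddphi i 0 c) ->
  inner (h (phi x)) (tension g h phi x) W =
  r * \sum_i (inner (h (phi x)) (ddphi i) W
    - \sum_k christoffel g k i i x * inner (h (phi x)) (dphi k) W
    + D (dphi i) (dphi i) W - 2^-1 * D W (dphi i) (dphi i)).
Proof.
move=> hT hU gI Dtri hD dE ddE; set H := inner (h (phi x)).
have HD k u u' : H (k *: u + u') W = k * H u W + H u' W by exact: innerDl.
have H0 : H 0 W = 0.
  by have := HD (-1) 0 0; rewrite scaler0 addr0 mulN1r addNr.
have Hs k (c : 'I_k -> R) (u : 'I_k -> 'rV[R]_p) :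
    H (\sum_i c i *: u i) W = \sum_i c i * H (u i) W.
  by elim/big_rec2: _ => [|i y z _ <-].
have -> : tension g h phi x = \sum_i r *: second_fundamental_form g h phi i i x.
  apply: eq_bigr => i _; rewrite (bigD1 i) //= big1 ?addr0 => [|j ji].
    by rewrite gI mxE eqxx mulr1n.
  by rewrite gI mxE eq_sym (negbTE ji) mulr0n scale0r.
rewrite Hs mulr_sumr; apply: eq_bigr => i _; congr (_ * _).
pose Q : 'rV[R]_p := \row_c \sum_d \sum_e
  christoffel h c d e (phi x) * dphi i 0 d * dphi i 0 e.
have -> : second_fundamental_form g h phi i i x =
    (-1) *: (\sum_k christoffel g k i i x *: dphi k) + (1 *: ddphi i + Q).
  apply/rowP => c; rewrite !mxE summxE ddE mulN1r mul1r.
  rewrite addrCA addrA; congr (_ - _ + _).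
    by apply: eq_bigr => k _; rewrite mxE dE.
  by apply: eq_bigr => d _; apply: eq_bigr => e _; rewrite !dE.
rewrite !HD Hs mulN1r mul1r [LHS]addrCA -[RHS]addrA [LHS]addrA; congr (_ + _).
(* Contracting with [W] moves the metric onto the upper Christoffel index, where [christoffel_lower]
   cancels the inverse matrix. *)
have -> : H Q W = \sum_d \sum_e \sum_l dphi i 0 d * dphi i 0 e * W 0 l *
    (2^-1 * (D (delta_mx 0 d) (delta_mx 0 e) (delta_mx 0 l)
      + D (delta_mx 0 e) (delta_mx 0 d) (delta_mx 0 l)
      - D (delta_mx 0 l) (delta_mx 0 d) (delta_mx 0 e))).
  rewrite /H innerE exchange_big /=.
  under eq_bigr => l _.
    under eq_bigr => c _.
      rewrite mxE mulr_suml mulr_suml.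
      under eq_bigr do rewrite mulr_suml mulr_suml.
      over.
    rewrite exchange_big /=; under eq_bigr do rewrite exchange_big /=.
    over.
  rewrite exchange_big; apply: eq_bigr => d _ /=.
  rewrite exchange_big; apply: eq_bigr => e _ /=; apply: eq_bigr => l _.
  rewrite -!hD -christoffel_lower // mulr_sumr.
  by apply: eq_bigr => c _; ring.
rewrite (trilinear_sum D (dphi i)) // (trilinear_sum D W) //.
under eq_bigr do (under eq_bigr do under eq_bigr do rewrite !(mulrBr, mulrDr);
  under eq_bigr do rewrite sumrB big_split /=; rewrite sumrB big_split /=).
rewrite sumrB big_split /=; congr (_ - _).
  (* Swapping [d] and [e] identifies the first two sums, because both slots carry [dphi i]. *)
  rewrite [X in _ + X]exchange_big /= -big_split; apply: eq_bigr => d _.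
  rewrite -big_split; apply: eq_bigr => e _ /=; rewrite -big_split /=.
  by apply: eq_bigr => l _; field.
rewrite mulr_sumr.
transitivity (\sum_l \sum_d \sum_e dphi i 0 d * dphi i 0 e * W 0 l *
    (2^-1 * D (delta_mx 0 l) (delta_mx 0 d) (delta_mx 0 e))).
  by rewrite [RHS]exchange_big; apply: eq_bigr => d _ /=; rewrite exchange_big.
apply: eq_bigr => l _; rewrite mulr_sumr; apply: eq_bigr => d _.
by rewrite mulr_sumr; apply: eq_bigr => e _; ring.
Qed.
End Lowering.

(** * The round metric and its connection in a stereographic chart *)

Section StereographicChart.
Context {R : realType} {n : nat}.
Implicit Types (x u v e : 'rV[R]_n) (s : bool).

Definition snorm x : R := 1 + dotv x x.

Lemma snorm_gt0 x : 0 < snorm x.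
Proof. by rewrite ltr_pwDl // dotv_ge0. Qed.

Lemma snorm_neq0 x : snorm x != 0.
Proof. by rewrite gt_eqF // snorm_gt0. Qed.

(** The conformal factor: in both charts the round metric is [conf x] times the Euclidean one. *)
Definition conf x : R := 4 / snorm x ^+ 2.

Lemma conf_gt0 x : 0 < conf x.
Proof. by rewrite divr_gt0 // exprn_gt0 // snorm_gt0. Qed.

Lemma is_derive_snorm {k} {w z : 'rV[R]_k} {X : 'rV[R]_k -> 'rV[R]_n} {X' : 'rV[R]_n} :
  (forall i, is_derive z w (fun y => X y 0 i) (X' 0 i)) ->
  is_derive z w (fun y => snorm (X y)) (2 * dotv (X z) X').
Proof.
move=> H; have := is_derive_addf (is_derive_cst (1 : R) z w) (is_derive_dotvf H H).
by move=> H'; apply: is_derive_eq; rewrite (dotvC X'); ring.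
Qed.

Lemma is_derive_conf {k} {w z : 'rV[R]_k} {X : 'rV[R]_k -> 'rV[R]_n} {X' : 'rV[R]_n} :
  (forall i, is_derive z w (fun y => X y 0 i) (X' 0 i)) ->
  is_derive z w (fun y => conf (X y))
    (- 4 * dotv (X z) X' / snorm (X z) * conf (X z)).
Proof.
move=> /is_derive_snorm H; have := is_derive_mulf H H => H2.
have := is_derive_scalef 4 (is_derive_invf _ H2).
rewrite mulf_neq0 ?snorm_neq0 // => /(_ isT) H3.
apply: is_derive_eq; rewrite /conf; field; exact: snorm_neq0.
Qed.

Lemma sphere_metric_conf s x : sphere_metric s x = (conf x)%:M.
Proof. by rewrite sphere_metricE. Qed.

Lemma invmx_sphere_metric s x : invmx (sphere_metric s x) = (conf x)^-1%:M.
Proof. by rewrite sphere_metric_conf invmx_scalar. Qed.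

Lemma partial_sphere_metric s x l i j :
  partial l (fun y => sphere_metric s y i j) x =
    (i == j)%:R * (- 4 * x 0 l / snorm x * conf x).
Proof.
apply: partialE; rewrite (_ : (fun y => _) = (fun y => (i == j)%:R * conf y)).
  have := @is_derive_conf _ (delta_mx 0 l) x id _ (is_derive_coord x _).
  move=> /(is_derive_scalef (i == j)%:R) H.
  by apply: is_derive_eq; rewrite dotv_delta.
by apply/funext => y; rewrite sphere_metric_conf mxE mulr_natl.
Qed.

(** The usual formula for a conformally flat metric exp(2 phi) times the Euclidean one, with phi =
    log (2 / snorm), whose i-th derivative is - 2 x_i / snorm. *)
Lemma sphere_christoffel s k i j x :
  christoffel (sphere_metric s) k i j x =
    - 2 / snorm x * ((j == k)%:R * x 0 i + (i == k)%:R * x 0 j - (i == j)%:R * x 0 k).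
Proof.
rewrite /christoffel invmx_sphere_metric (bigD1 k) //= big1 ?addr0 => [|l lk].
  rewrite !partial_sphere_metric mxE eqxx mulr1n.
  by field; rewrite snorm_neq0 gt_eqF ?conf_gt0.
by rewrite mxE eq_sym (negbTE lk) mulr0n mul0r.
Qed.

(** The Christoffel symbols contracted with [u] and [e], in closed form. The choice of pole [s] has
    disappeared. *)
Definition sconn x u e : 'rV[R]_n :=
  (- 2 / snorm x) *: (dotv x u *: e + dotv x e *: u - dotv u e *: x).

Lemma sphere_conn s x u e : conn (sphere_metric s) x u e = sconn x u e.
Proof.
have dl (p : 'I_n) (F : 'I_n -> R) : \sum_k (k == p)%:R * F k = F p.
  rewrite (bigD1 p) //= eqxx mul1r big1 ?addr0 // => k kp.
  by rewrite (negbTE kp) mul0r.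
apply/rowP => k; rewrite !mxE.
transitivity (\sum_i (- 2 / snorm x) * (x 0 i * u 0 i * e 0 k
   + (i == k)%:R * u 0 i * dotv x e - x 0 k * (u 0 i * e 0 i))).
  apply: eq_bigr => i _.
  transitivity (\sum_j (- 2 / snorm x) * ((j == k)%:R * (x 0 i * u 0 i * e 0 j) +
     (i == k)%:R * u 0 i * (x 0 j * e 0 j) - (j == i)%:R * (x 0 k * u 0 i * e 0 j))).
    by apply: eq_bigr => j _; rewrite sphere_christoffel (eq_sym i j); ring.
  rewrite -mulr_sumr sumrB big_split /= !dl -mulr_sumr.
  by congr (_ * (_ - _)); ring.
rewrite -mulr_sumr sumrB big_split /= -mulr_suml -mulr_sumr.
rewrite (_ : \sum_i _ * u 0 i * _ = u 0 k * dotv x e).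
  by rewrite -/(dotv x u) -/(dotv u e); congr (_ * (_ - _)); ring.
by rewrite -mulr_suml dl.
Qed.

Lemma sum_christoffel_diag s x i (G : 'I_n -> R) :
  \sum_k christoffel (sphere_metric s) k i i x * G k =
    - 2 / snorm x * (2 * x 0 i * G i - \sum_k x 0 k * G k).
Proof.
transitivity (\sum_k (- 2 / snorm x) * (2 * x 0 i * ((i == k)%:R * G k) - x 0 k * G k)).
  by apply: eq_bigr => k _; rewrite sphere_christoffel eqxx /=; ring.
rewrite -mulr_sumr sumrB -mulr_sumr; congr (_ * (_ * _ - _)).
by rewrite (bigD1 i) //= eqxx mul1r big1 ?addr0 // => k ki; rewrite eq_sym (negbTE ki) mul0r.
Qed.

End StereographicChart.

(** * The conformal gradient field in a chart *)

Section ConformalField.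
Context {R : realType} {n : nat}.
Variables (c : R) (b : 'rV[R]_n).
Implicit Types x : 'rV[R]_n.

(* The field and its potential in the chart: [c] and [b] are the components of
   [a] along and orthogonal to the axis of the projection. *)
Definition cfield x : 'rV[R]_n := (c - dotv b x) *: x + (snorm x / 2) *: b.
Definition height x : R := (c * (snorm x - 2) + 2 * dotv b x) / snorm x.

Lemma is_derive_dotvl (w : 'rV[R]_n) x v : is_derive x v (dotv w) (dotv w v).
Proof.
have := @is_derive_dotvf _ _ _ x v (cst w) id 0 v.
rewrite dotv0l add0r; apply=> i; last exact: is_derive_coord.
by rewrite mxE; exact: is_derive_cst.
Qed.

(** As the metric is [conf] times the identity, this identifies [cfield] as the Riemannian gradient
    of [height]. *)
Lemma partial_height i x : partial i height x = conf x * cfield x 0 i.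
Proof.
apply: partialE.
have HN := @is_derive_snorm _ _ _ (delta_mx 0 i) x id _ (is_derive_coord x _).
have HI := is_derive_invf (snorm_neq0 x) HN.
have Hb := is_derive_dotvl b x (delta_mx 0 i).
have H := is_derive_mulf (is_derive_addf
  (is_derive_scalef c (is_derive_addf HN
     (is_derive_cst (- 2 : R) x (delta_mx 0 i)))) (is_derive_scalef 2 Hb)) HI.
apply: is_derive_eq; rewrite !dotv_delta /conf !mxE /=.
by field; exact: snorm_neq0.
Qed.

Definition dcfield x i : 'rV[R]_n :=
  (c - dotv b x) *: delta_mx 0 i - b 0 i *: x + x 0 i *: b.

Lemma partial_cfield x i j : partial i (fun y => cfield y 0 j) x = dcfield x i 0 j.
Proof.
apply: partialE; set e := delta_mx 0 i.
have HN := @is_derive_snorm _ _ _ e x id _ (is_derive_coord x _).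
have Hb := is_derive_dotvl b x e.
have Hx := is_derive_coord x e j.
rewrite (_ : (fun y => _) = fun y =>
    (c + (-1) * dotv b y) * y 0 j + b 0 j / 2 * snorm y); last first.
  by apply/funext => y; rewrite 2!mxE [in X in _ + X]mxE; ring.
have H := is_derive_addf (is_derive_mulf
  (is_derive_addf (is_derive_cst c x e) (is_derive_scalef (-1) Hb)) Hx)
  (is_derive_scalef (b 0 j / 2) HN).
by apply: is_derive_eq; rewrite !dotv_delta !mxE /=; field.
Qed.

(** The field is quadratic in the chart, so its second derivatives are constant; only the pure ones
    enter the trace for a conformal metric. *)
Definition ddcfield i : 'rV[R]_n := b - (2 * b 0 i) *: delta_mx 0 i.

Lemma partial_dcfield x i j : partial i (fun y => dcfield y i 0 j) x = ddcfield i 0 j.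
Proof.
apply: partialE; set e := delta_mx 0 i.
have Hb := is_derive_dotvl b x e.
rewrite (_ : (fun y => _) = fun y =>
    (c + (-1) * dotv b y) * e 0 j + ((- b 0 i) * y 0 j + b 0 j * y 0 i)); last first.
  by apply/funext => y; rewrite /dcfield -/e !mxE; ring.
have H := is_derive_addf (is_derive_mulf
  (is_derive_addf (is_derive_cst c x e) (is_derive_scalef (-1) Hb))
  (is_derive_cst (e 0 j) x e)) (is_derive_addf
   (is_derive_scalef (- b 0 i) (is_derive_coord x e j))
   (is_derive_scalef (b 0 j) (is_derive_coord x e i))).
apply: is_derive_eq; rewrite !dotv_delta !mxE /= !eqxx /=.
by case: eqP => [->|_] /=; ring.
Qed.

(* The field is conformal and closed: nabla_X sigma = - lambda X. *)
Lemma nabla_cfield x i :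
  dcfield x i + sconn x (delta_mx 0 i) (cfield x) = - height x *: delta_mx 0 i.
Proof.
have XE : dotv x x = snorm x - 1 by rewrite /snorm; ring.
apply/rowP => j; rewrite !mxE !bidotvE !dotv_delta !dotv_deltal XE ?mxE (dotvC b x).
by rewrite /height (dotvC b x); field; exact: snorm_neq0.
Qed.

(** Pythagoras: [a] is the orthogonal sum of sigma and of lambda times the point of the sphere, and
    the squared norm of [a] is [c ^+ 2 + dotv b b]. *)
Lemma normsq_cfield x :
  conf x * dotv (cfield x) (cfield x) = c ^+ 2 + dotv b b - height x ^+ 2.
Proof.
have XE : dotv x x = snorm x - 1 by rewrite /snorm; ring.
rewrite !bidotvE XE (dotvC b x) /height /conf (dotvC b x).
by field; exact: snorm_neq0.
Qed.

End ConformalField.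

(** * Identification of the gradient of the height function with the chart field *)

Section Gradient.
Context {R : realType} {n : nat}.
Variables (a : 'rV[R]_n.+1) (s : bool).
Implicit Types x : 'rV[R]_n.

Definition axial : R := (-1) ^+ s * a 0 0.
Definition equatorial : 'rV[R]_n := \row_i a 0 (lift 0 i).

Let c := axial.
Let b := equatorial.

Lemma dotv_stereo x : dotv a (stereo s x) = height c b x.
Proof.
rewrite /dotv big_ord_recl stereo0; under eq_bigr do rewrite stereoS.
rewrite /height -/(snorm x).
rewrite (_ : \sum_i _ = 2 / snorm x * dotv b x); last first.
  by rewrite /dotv mulr_sumr; apply: eq_bigr => i _; rewrite mxE; ring.
rewrite /c /axial /= (_ : dotv x x = snorm x - 1); last by rewrite /snorm; ring.
by field; exact: snorm_neq0.
Qed.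

Lemma sphere_grad_cfield x :
  sphere_grad (fun p : 'rV[R]_n.+1 => dotv a p) s x = cfield c b x.
Proof.
apply/rowP => i; rewrite mxE invmx_sphere_metric.
rewrite (_ : _ \o _ = height c b); last by apply/funext => y; exact: dotv_stereo.
rewrite (bigD1 i) //= big1 ?addr0 => [|l lk]; last first.
  by rewrite mxE eq_sym (negbTE lk) mulr0n mul0r.
rewrite mxE eqxx mulr1n partial_height mulrA mulVf ?mul1r //.
by rewrite gt_eqF ?conf_gt0.
Qed.

Lemma dotv_coords : dotv a a = c ^+ 2 + dotv b b.
Proof.
rewrite /c /axial /dotv big_ord_recl exprMn sqrr_sign mul1r expr2; congr (_ + _).
by apply: eq_bigr => i _; rewrite /b /equatorial !mxE.
Qed.

End Gradient.

(** * The Kaluza-Klein metric over the sphere with C = 0, and its first derivatives *)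

Section KaluzaKleinSphere.
Context {R : realType} {n : nat}.
Variables (A B : R -> R) (s : bool).
Implicit Types (x p : 'rV[R]_n) (z w u v : 'rV[R]_(n + n)).

Definition skk : 'rV[R]_(n + n) -> 'M[R]_(n + n) :=
  kaluza_klein (@sphere_metric R n s) A B (fun _ => 0).

Definition sqn z : R := conf (lsubmx z) * dotv (rsubmx z) (rsubmx z).

Definition svpart z w : 'rV[R]_n := rsubmx w + sconn (lsubmx z) (lsubmx w) (rsubmx z).

Lemma vpart_sphere z w : vpart (@sphere_metric R n s) z w = svpart z w.
Proof. by rewrite /vpart sphere_conn. Qed.

Lemma inner_skk z u v :
  inner (skk z) u v = conf (lsubmx z) * (A (sqn z) * dotv (lsubmx u) (lsubmx v)
    + B (sqn z) * dotv (svpart z u) (svpart z v)).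
Proof.
rewrite kaluza_kleinE /kaluza_klein_form !sphere_metric_conf !inner_scalar_mx.
by rewrite !vpart_sphere /hpart -/(sqn z); ring.
Qed.

Lemma skk_sym z : (skk z)^T = skk z.
Proof.
apply/matrixP => i j; rewrite !mxE /kaluza_klein_form.
rewrite !sphere_metric_conf !inner_scalar_mx !(dotvC (hpart (delta_mx _ j))).
by rewrite !(dotvC (vpart _ _ (delta_mx _ j)) (vpart _ _ _)) !mul0r.
Qed.

(* The derivatives of [sqn], [svpart] and [skk] at [z] in the direction [w];
   [A1] and [B1] stand for the derivatives of [A] and [B] at [sqn z]. *)
Definition dsqn z w : R := conf (lsubmx z) *
  (- 4 * dotv (lsubmx z) (lsubmx w) / snorm (lsubmx z) * dotv (rsubmx z) (rsubmx z)
   + 2 * dotv (rsubmx z) (rsubmx w)).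

Definition dsvpart z w u : 'rV[R]_n :=
  let x := lsubmx z in let e := rsubmx z in let p := lsubmx w in let h := lsubmx u in
  sconn x h (rsubmx w) + (- 2 / snorm x) *:
    (dotv p h *: e + dotv p e *: h - dotv h e *: p
     - (2 * dotv x p / snorm x) *: (dotv x h *: e + dotv x e *: h - dotv h e *: x)).

Definition dskk (A1 B1 : R) z w u v : R := conf (lsubmx z) *
  (- 4 * dotv (lsubmx z) (lsubmx w) / snorm (lsubmx z) *
     (A (sqn z) * dotv (lsubmx u) (lsubmx v)
      + B (sqn z) * dotv (svpart z u) (svpart z v))
   + dsqn z w * (A1 * dotv (lsubmx u) (lsubmx v) + B1 * dotv (svpart z u) (svpart z v))
   + B (sqn z) * (dotv (dsvpart z w u) (svpart z v) + dotv (svpart z u) (dsvpart z w v))).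

Lemma is_derive_lsubmx z w i :
  is_derive z w (fun y : 'rV[R]_(n + n) => lsubmx y 0 i) (lsubmx w 0 i).
Proof.
rewrite mxE (_ : (fun y => _) = fun y : 'rV[R]_(n + n) => y 0 (lshift n i)).
  exact: is_derive_coord.
by apply/funext => y; rewrite mxE.
Qed.

Lemma is_derive_rsubmx z w i :
  is_derive z w (fun y : 'rV[R]_(n + n) => rsubmx y 0 i) (rsubmx w 0 i).
Proof.
rewrite mxE (_ : (fun y => _) = fun y : 'rV[R]_(n + n) => y 0 (rshift n i)).
  exact: is_derive_coord.
by apply/funext => y; rewrite mxE.
Qed.

Lemma is_derive_sqn z w : is_derive z w sqn (dsqn z w).
Proof.
have H := is_derive_mulf (is_derive_conf (is_derive_lsubmx z w))
  (is_derive_dotvf (is_derive_rsubmx z w) (is_derive_rsubmx z w)).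
by apply: is_derive_eq; rewrite /dsqn (dotvC (rsubmx w)); ring.
Qed.

Lemma is_derive_svpart z w u i :
  is_derive z w (fun y => svpart y u 0 i) (dsvpart z w u 0 i).
Proof.
pose h := lsubmx u.
have hi k : is_derive z w (fun=> h 0 k) ((0 : 'rV[R]_n) 0 k).
  have -> : (0 : 'rV[R]_n) 0 k = 0 by rewrite mxE.
  exact: (is_derive_cst (h 0 k)).
have Hl := is_derive_lsubmx z w; have Hr := is_derive_rsubmx z w.
have HN := @is_derive_invf _ _ z w (fun y => snorm (lsubmx y)) _ (snorm_neq0 _)
  (is_derive_snorm Hl).
have H1 := is_derive_mulf (@is_derive_dotvf _ _ _ _ _ _ (fun=> h) _ _ Hl hi) (Hr i).
have H2 := is_derive_mulf (is_derive_dotvf Hl Hr) (hi i).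
have H3 := is_derive_mulf (@is_derive_dotvf _ _ _ _ _ (fun=> h) _ _ _ hi Hr) (Hl i).
have H := is_derive_addf (is_derive_cst (rsubmx u 0 i) z w)
  (is_derive_scalef (- 2) (is_derive_mulf HN
    (is_derive_addf H1 (is_derive_addf H2
       (is_derive_scalef (-1) H3))))).
rewrite (_ : (fun y => _) = fun y => rsubmx u 0 i + - 2 * ((snorm (lsubmx y))^-1 *
    (dotv (lsubmx y) h * rsubmx y 0 i + (dotv (lsubmx y) (rsubmx y) * h 0 i
      + (-1) * (dotv h (rsubmx y) * lsubmx y 0 i))))); last first.
  by apply/funext => y; rewrite /svpart /sconn -/h !mxE; ring.
apply: is_derive_eq.
rewrite /dsvpart /sconn -/h !dotv0l !dotv0r !mxE /=.
by field; exact: snorm_neq0.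
Qed.

Lemma is_derive_skk A1 B1 z w u v :
  is_derive (sqn z) 1 A A1 -> is_derive (sqn z) 1 B B1 ->
  is_derive z w (fun y => inner (skk y) u v) (dskk A1 B1 z w u v).
Proof.
move=> HA HB; rewrite (_ : (fun y => _) = fun y => conf (lsubmx y) *
    (A (sqn y) * dotv (lsubmx u) (lsubmx v)
      + B (sqn y) * dotv (svpart y u) (svpart y v))); last first.
  by apply/funext => y; exact: inner_skk.
have Ht := is_derive_sqn z w.
have H := is_derive_mulf (is_derive_conf (is_derive_lsubmx z w))
  (is_derive_addf
    (is_derive_mulf (is_derive_compf HA Ht)
       (is_derive_cst (dotv (lsubmx u) (lsubmx v)) z w))
    (is_derive_mulf (is_derive_compf HB Ht)
       (is_derive_dotvf (is_derive_svpart z w u) (is_derive_svpart z w v)))).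
by apply: is_derive_eq; rewrite /dskk /=; ring.
Qed.

Lemma partial_skk A1 B1 z i j k :
  is_derive (sqn z) 1 A A1 -> is_derive (sqn z) 1 B B1 ->
  partial i (fun y => skk y j k) z =
    dskk A1 B1 z (delta_mx 0 i) (delta_mx 0 j) (delta_mx 0 k).
Proof.
move=> HA HB; apply: partialE.
rewrite (_ : (fun y => _) = fun y => inner (skk y) (delta_mx 0 j) (delta_mx 0 k)).
  exact: is_derive_skk.
by apply/funext => y; rewrite kaluza_kleinE mxE.
Qed.

Lemma svpartP z k w w' : svpart z (k *: w + w') = k *: svpart z w + svpart z w'.
Proof. by rewrite -!vpart_sphere vpartD. Qed.

Lemma dsvpartPl z k w w' u :
  dsvpart z (k *: w + w') u = k *: dsvpart z w u + dsvpart z w' u.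
Proof.
rewrite /dsvpart !linearP /sconn; apply/rowP => i; rewrite !bidotvE !mxE /=; ring.
Qed.

Lemma dsvpartPr z k w u u' :
  dsvpart z w (k *: u + u') = k *: dsvpart z w u + dsvpart z w u'.
Proof.
rewrite /dsvpart !linearP /sconn; apply/rowP => i; rewrite !bidotvE !mxE /=; ring.
Qed.

Lemma dskk_trilinear A1 B1 z : trilinear (dskk A1 B1 z).
Proof.
have lP k (w w' : 'rV[R]_(n + n)) : lsubmx (k *: w + w') = k *: lsubmx w + lsubmx w'.
  exact: linearP.
have rP k (w w' : 'rV[R]_(n + n)) : rsubmx (k *: w + w') = k *: rsubmx w + rsubmx w'.
  exact: linearP.
have tP k w w' : dsqn z (k *: w + w') = k * dsqn z w + dsqn z w'.
  by rewrite /dsqn lP rP !bidotvE; ring.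
split=> k w w' u v; rewrite /dskk.
- rewrite tP !dsvpartPl lP; move: (dsvpart z w u) (dsvpart z w' u) (dsvpart z w v)
    (dsvpart z w' v) (svpart z u) (svpart z v) => d1 d2 d3 d4 d5 d6.
  by rewrite !bidotvE; ring.
- rewrite !dsvpartPr lP !svpartP; move: (dsvpart z w w') (dsvpart z w u)
    (dsvpart z w v) (svpart z w') (svpart z u) (svpart z v) => d1 d2 d3 d4 d5 d6.
  by rewrite !bidotvE; ring.
- rewrite !dsvpartPr lP !svpartP; move: (dsvpart z w w') (dsvpart z w u)
    (dsvpart z w v) (svpart z w') (svpart z u) (svpart z v) => d1 d2 d3 d4 d5 d6.
  by rewrite !bidotvE; ring.
Qed.

(** A kernel vector would have zero length, against positive definiteness at [z]. *)
Lemma skk_unit z : 0 < A (sqn z) -> 0 < B (sqn z) -> skk z \in unitmx.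
Proof.
move=> A0 B0; have [_ Hpos] : is_inner (skk z).
  apply: kaluza_klein_is_inner => //; first exact: sphere_metric_is_inner.
    by rewrite sphere_metric_conf inner_scalar_mx.
  by rewrite sphere_metric_conf inner_scalar_mx.
rewrite unitmxE unitfE; apply/negP => /det0P[u u0 uH].
by have := Hpos u u0; rewrite /inner uH mul0mx mxE ltxx.
Qed.

End KaluzaKleinSphere.

(** * Diagonal entries of the derivative of the vertical projection *)

Section DsvpartDiag.
Context {R : realType} {n : nat}.
Implicit Types x e p r u : 'rV[R]_n.

Lemma dotv_sconn x u p e :
  dotv u (sconn x p e) =
    - 2 / snorm x * (dotv x p * dotv u e + dotv x e * dotv u p - dotv p e * dotv u x).
Proof. by rewrite /sconn !bidotvE; ring. Qed.

(** On the diagonal the terms carrying the index [i] cancel in pairs. The value is independent of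
    [i], so the trace is just [n] times it. *)
Lemma dsvpart_diagr x e p r u i :
  dsvpart (row_mx x e) (row_mx p r) (row_mx (delta_mx 0 i) u) 0 i =
    - 2 / snorm x * (dotv x r + dotv p e - 2 * dotv x p / snorm x * dotv x e).
Proof.
rewrite /dsvpart /sconn !row_mxKl !row_mxKr !mxE !eqxx !dotv_delta !dotv_deltal /=.
by field; exact: snorm_neq0.
Qed.

Lemma dsvpart_diagl x e p r u i :
  dsvpart (row_mx x e) (row_mx (delta_mx 0 i) u) (row_mx p r) 0 i =
    - 2 / snorm x * (dotv x p * u 0 i + dotv x u * p 0 i - dotv p u * x 0 i
      + 2 * e 0 i * p 0 i - dotv p e
      - 2 * x 0 i / snorm x * (dotv x p * e 0 i + dotv x e * p 0 i - dotv p e * x 0 i)).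
Proof.
rewrite /dsvpart /sconn !row_mxKl !row_mxKr !mxE !eqxx !dotv_delta !dotv_deltal /=.
by field; exact: snorm_neq0.
Qed.
End DsvpartDiag.

(** * The tension field of the conformal field, paired with lifts *)

Section TensionConformalField.
Context {R : realType} {n : nat}.
Variables (A B : R -> R) (s : bool) (c : R) (b : 'rV[R]_n) (x : 'rV[R]_n).
Implicit Types (p q : 'rV[R]_n).

Let sigma := cfield c b x.
Let lam := height c b x.
Let f := conf x.
Let N := snorm x.
Let z : 'rV[R]_(n + n) := row_mx x sigma.
Let t := sqn z.

(** The first and the pure second derivatives of sigma as a map into the tangent bundle; [hl p] is
    the horizontal lift of [p] at [z]. *)
Let dphi i : 'rV[R]_(n + n) := row_mx (delta_mx 0 i) (dcfield c b x i).
Let ddphi i : 'rV[R]_(n + n) := row_mx 0 (ddcfield b i).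
Let hl p : 'rV[R]_(n + n) := row_mx p (- sconn x p sigma).

(** The vertical part of the differential of sigma is its covariant derivative, so [dphi i] is the
    horizontal lift of the i-th basis vector minus lambda times its vertical lift. *)
Lemma svpart_dphi i : svpart z (dphi i) = - lam *: delta_mx 0 i.
Proof. by rewrite /svpart !row_mxKl !row_mxKr nabla_cfield. Qed.

Lemma svpart_vlift q : svpart z (row_mx 0 q) = q.
Proof.
by rewrite /svpart /sconn !row_mxKl !row_mxKr dotv0r dotv0l !scale0r scaler0
  addr0 subr0 scaler0 addr0.
Qed.

Lemma svpart_hlift p : svpart z (hl p) = 0.
Proof. by rewrite /svpart !row_mxKl !row_mxKr addNr. Qed.

Let XE : dotv x x = N - 1. Proof. by rewrite /N /snorm addrAC subrr add0r. Qed.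
Let N0 : N != 0. Proof. exact: snorm_neq0. Qed.

(** This differentiates |sigma|^2 = |a|^2 - lambda^2, the i-th derivative of lambda being
    [f * sigma 0 i]. *)
Lemma dsqn_dphi i : dsqn z (dphi i) = - 2 * lam * f * sigma 0 i.
Proof.
rewrite /dsqn !row_mxKl !row_mxKr dotv_delta /sigma /cfield /dcfield.
rewrite !bidotvE !dotv_delta XE /lam /height /f /conf -/N !mxE.
by rewrite !(dotvC b x); field.
Qed.

(* d/dx_i of nabla_i sigma = - lambda e_i. *)
Lemma dsvpart_dphi i :
  dsvpart z (dphi i) (dphi i) = - (f * sigma 0 i) *: delta_mx 0 i - ddcfield b i.
Proof.
rewrite /dsvpart !row_mxKl !row_mxKr; apply/rowP => j.
rewrite /sconn /sigma /cfield /dcfield /ddcfield !mxE !bidotvE !dotv_delta !dotv_deltal.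
rewrite XE /f /conf -/N !mxE eqxx !(dotvC b x).
by rewrite eqxx; case: eqP => [->|_] /=; field.
Qed.

Hypotheses (A_gt0 : 0 < A t) (B_gt0 : 0 < B t).
Variables (A1 B1 : R).
Hypotheses (dA : is_derive t 1 A A1) (dB : is_derive t 1 B B1).

Let tau := tension (@sphere_metric R n s) (skk A B s)
  (fun y => row_mx y (cfield c b y)) x.

(** An instance of [tension_lower]. [W] stays arbitrary so that vertical and horizontal lifts can
    both be substituted; the two traces of [dsvpart] are left unevaluated because they differ in the
    two cases. *)
Lemma tension_cfield_lower W :
  let p := lsubmx W in let q := svpart z W in
  inner (skk A B s z) tau W =
    - f * B t * dotv sigma q
    - 2 * n%:R / N * (A t * dotv x p - B t * lam * dotv x q)
    - 2 * lam * f * (A1 * dotv sigma p - B1 * lam * dotv sigma q)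
    - n%:R / 2 * (- 4 * dotv x p / N * (A t + B t * lam ^+ 2)
                  + dsqn z W * (A1 + B1 * lam ^+ 2))
    + B t * lam * (\sum_i dsvpart z W (dphi i) 0 i - \sum_i dsvpart z (dphi i) W 0 i).
Proof.
pose D := dskk A B A1 B1 z.
have phi_l k : (fun y : 'rV[R]_n => (row_mx y (cfield c b y) : 'rV[R]_(n + n)) 0 (lshift n k))
    = fun y => y 0 k by apply/funext => y; rewrite row_mxEl.
have phi_r k : (fun y : 'rV[R]_n => (row_mx y (cfield c b y) : 'rV[R]_(n + n)) 0 (rshift n k))
    = fun y => cfield c b y 0 k by apply/funext => y; rewrite row_mxEr.
have dx i k y : partial i (fun y : 'rV[R]_n => y 0 k) y = (delta_mx 0 i : 'rV[R]_n) 0 k.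
  by apply: partialE; exact: is_derive_coord.
have E := tension_lower (@sphere_metric R n s) (skk A B s)
  (fun y => row_mx y (cfield c b y)) x f^-1 D dphi ddphi W.
move=> p q; apply: etrans (E _ _ _ _ _ _ _) _ => {E}.
- exact: skk_sym.
- exact: skk_unit.
- exact: invmx_sphere_metric.
- exact: dskk_trilinear.
- by move=> i j k; exact: partial_skk.
- move=> i k; case: (split_ordP k) => {}k ->.
    by rewrite phi_l row_mxEl dx.
  by rewrite phi_r row_mxEr partial_cfield.
- move=> i k; case: (split_ordP k) => {}k ->.
    rewrite phi_l row_mxEl mxE.
    rewrite (_ : partial i (fun y : 'rV[R]_n => y 0 k) = cst ((delta_mx 0 i : 'rV[R]_n) 0 k)).
      by apply: partialE; exact: is_derive_cst.
    by apply/funext => y; exact: dx.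
  rewrite phi_r row_mxEr.
  rewrite (_ : partial i (fun y => cfield c b y 0 k) = fun y => dcfield c b y i 0 k).
    exact: partial_dcfield.
  by apply/funext => y; exact: partial_cfield.
rewrite -/sigma -/z.
have inner_dphi k : inner (skk A B s z) (dphi k) W = f * (A t * p 0 k - B t * lam * q 0 k).
  rewrite inner_skk svpart_dphi !row_mxKl dotvZl !dotv_deltal -/p -/q -/t -/f; ring.
have inner_ddphi i : inner (skk A B s z) (ddphi i) W = f * (B t * dotv (ddcfield b i) q).
  by rewrite inner_skk svpart_vlift !row_mxKl dotv0l -/q -/t -/f; ring.
(* The [ddcfield] term here cancels the contribution [inner_ddphi] of the second derivatives of
   sigma. *)
have D1 i : D (dphi i) (dphi i) W = f * (- 4 * x 0 i / N * (A t * p 0 i - B t * lam * q 0 i)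
    - 2 * lam * f * sigma 0 i * (A1 * p 0 i - B1 * lam * q 0 i)
    + B t * (- (f * sigma 0 i) * q 0 i - dotv (ddcfield b i) q
             - lam * dsvpart z (dphi i) W 0 i)).
  rewrite /D /dskk dsvpart_dphi svpart_dphi dsqn_dphi !row_mxKl -/p -/q -/t -/f -/N.
  rewrite dotv_delta dotvZl !dotv_deltal dotvDl dotvNl !dotvZl !dotv_deltal; ring.
have D2 i : D W (dphi i) (dphi i) = f * (- 4 * dotv x p / N * (A t + B t * lam ^+ 2)
    + dsqn z W * (A1 + B1 * lam ^+ 2) - 2 * B t * lam * dsvpart z W (dphi i) 0 i).
  rewrite /D /dskk svpart_dphi !row_mxKl -/p -/q -/t -/f -/N.
  rewrite !dotvZl !dotvZr (dotv_delta (dsvpart z W (dphi i))) !dotv_deltal.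
  by rewrite mxE !eqxx /=; ring.
pose G k := A t * p 0 k - B t * lam * q 0 k.
have GE : \sum_k x 0 k * (f * G k) = f * (A t * dotv x p - B t * lam * dotv x q).
  rewrite /dotv !mulr_sumr -sumrB mulr_sumr; apply: eq_bigr => k _; rewrite /G; ring.
(* The domain Christoffel terms proportional to [x 0 i] cancel the derivative of the conformal
   factor in [D1]. What remains of them does not depend on [i] and yields the factor [n]. *)
transitivity (\sum_i (- f * B t * (sigma 0 i * q 0 i)
    - 2 * lam * f * A1 * (sigma 0 i * p 0 i)
    + 2 * lam ^+ 2 * f * B1 * (sigma 0 i * q 0 i)
    + B t * lam * (dsvpart z W (dphi i) 0 i - dsvpart z (dphi i) W 0 i)
    - (2 / N * (A t * dotv x p - B t * lam * dotv x q)
       + 2^-1 * (- 4 * dotv x p / N * (A t + B t * lam ^+ 2)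
                  + dsqn z W * (A1 + B1 * lam ^+ 2))))).
  rewrite mulr_sumr; apply: eq_bigr => i _.
  rewrite inner_ddphi D1 D2 (eq_bigr _ (fun k _ => congr1 _ (inner_dphi k))).
  rewrite sum_christoffel_diag GE -/N.
  by field; rewrite N0 gt_eqF ?conf_gt0.
rewrite sumrB sumr_const card_ord !big_split /= -!mulr_sumr.
rewrite !sumrN -!mulr_sumr -/(dotv sigma q) -/(dotv sigma p).
rewrite -[X in _ - X = _]mulr_natl sumrB; field; exact: N0.
Qed.

(** For a vertical lift the second trace vanishes and the first one cancels the remaining term in
    [dotv x q], so only multiples of [dotv sigma q] survive. *)
Lemma tension_cfield_vlift q :
  inner (skk A B s z) tau (row_mx 0 q) =
    f * ((2 - n%:R) * lam ^+ 2 * B1 - B t - n%:R * A1) * dotv sigma q.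
Proof.
rewrite tension_cfield_lower svpart_vlift row_mxKl !dotv0r.
have -> : dsqn z (row_mx 0 q) = 2 * f * dotv sigma q.
  by rewrite /dsqn !row_mxKl !row_mxKr dotv0r -/f; ring.
have S2 : \sum_i dsvpart z (dphi i) (row_mx 0 q) 0 i = 0.
  rewrite big1 // => i _.
  rewrite /dsvpart /sconn !row_mxKl !row_mxKr !mxE !dotv0r !dotv0l; ring.
rewrite [X in _ + _ * (_ - X)]S2 (eq_bigr (fun=> - 2 / N * dotv x q)).
  by rewrite sumr_const card_ord -mulr_natl; field; exact: N0.
by move=> i _; rewrite dsvpart_diagr dotv0r dotv0l -/N; field; exact: N0.
Qed.

(* The curvature of the sphere enters through the second sum. *)
Lemma tension_cfield_hlift p :
  inner (skk A B s z) tau (hl p) =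
    - f * lam * (2 * A1 + (n%:R - 1) * B t) * dotv sigma p.
Proof.
rewrite tension_cfield_lower svpart_hlift row_mxKl !dotv0r.
have xs : dotv x sigma = (c - dotv b x) * (N - 1) + N / 2 * dotv b x.
  by rewrite /sigma /cfield !bidotvE XE (dotvC x b).
have sp : dotv sigma p = (c - dotv b x) * dotv x p + N / 2 * dotv b p.
  by rewrite /sigma /cfield !bidotvE.
(* Horizontal directions preserve the norm, since the connection is metric. *)
have -> : dsqn z (hl p) = 0.
  rewrite /dsqn !row_mxKl !row_mxKr dotvNr dotv_sconn (dotvC sigma x) (dotvC p sigma).
  by rewrite -/N; field; exact: N0.
have S1 : \sum_i dsvpart z (hl p) (dphi i) 0 i =
    n%:R * (- 2 / N * (2 / N * dotv x p * dotv x sigma + (2 - N) / N * dotv sigma p)).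
  rewrite (eq_bigr _ (fun i _ => dsvpart_diagr _ _ _ _ _ _)) sumr_const card_ord.
  rewrite -mulr_natl -/N dotvNr dotv_sconn XE.
  by rewrite (dotvC p sigma) -/N; field; exact: N0.
rewrite [X in _ + _ * (X - _)]S1.
have -> : \sum_i dsvpart z (dphi i) (hl p) 0 i =
   - 2 / N * (2 * dotv b x * dotv x p - 4 / N * dotv x sigma * dotv x p
     - 2 * (N - 1) * dotv b p + 2 * dotv sigma p + 2 / N * dotv sigma p * (N - 1)
     + n%:R * ((c - dotv b x) * dotv x p - dotv sigma p)).
  transitivity (\sum_i (- 2 / N) * ((dotv b x - 2 / N * dotv x sigma) * (x 0 i * p 0 i)
      - (N - 1) * (b 0 i * p 0 i) + 2 * (sigma 0 i * p 0 i)
      + dotv x p * (b 0 i * x 0 i) + (2 / N * dotv sigma p - dotv b p) * (x 0 i * x 0 i)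
      - 2 / N * dotv x p * (x 0 i * sigma 0 i)
      + ((c - dotv b x) * dotv x p - dotv sigma p))).
    apply: eq_bigr => i _; rewrite dsvpart_diagl -/N (dotvC p sigma) /dcfield.
    rewrite !mxE !bidotvE !dotv_delta XE eqxx (dotvC x b) (dotvC p b) (dotvC p x) /=.
    by rewrite eqxx -/N /=; field; exact: N0.
  rewrite -mulr_sumr; congr (_ * _).
  rewrite !big_split /= !sumrN -!mulr_sumr !sumr_const card_ord.
  rewrite -[dotv x p *+ n]mulr_natl -[dotv sigma p *+ n]mulr_natl.
  rewrite -/(dotv x p) -/(dotv b p) -/(dotv sigma p) -/(dotv b x) -/(dotv x x).
  rewrite -/(dotv x sigma) XE; field; exact: N0.
rewrite xs sp /lam /height /f /conf -/N.
field; exact: N0.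
Qed.

(** Pairing with the vertical lift of a basis vector reads off one coordinate of the vertical part,
    multiplied by the positive factor [f * B t]. Horizontal lifts give [lsubmx_tension] in the same
    way, with [f * A t]. *)
Lemma svpart_tension : svpart z tau =
  (((2 - n%:R) * lam ^+ 2 * B1 - B t - n%:R * A1) / B t) *: sigma.
Proof.
apply/rowP => i; have := tension_cfield_vlift (delta_mx 0 i).
rewrite inner_skk svpart_vlift !row_mxKl dotv0r !dotv_delta mulr0 add0r -/t -/f => E.
have f0 : f != 0 by rewrite gt_eqF ?conf_gt0.
have B0 : B t != 0 by rewrite gt_eqF.
apply: (mulfI (mulf_neq0 f0 B0)); rewrite -mulrA E [in RHS]mxE.
by move: (sigma 0 i) => y; field.
Qed.

Lemma lsubmx_tension :
  lsubmx tau = (- lam * (2 * A1 + (n%:R - 1) * B t) / A t) *: sigma.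
Proof.
apply/rowP => i; have := tension_cfield_hlift (delta_mx 0 i).
rewrite inner_skk svpart_hlift !row_mxKl dotv0r !dotv_delta mulr0 addr0 -/t -/f => E.
have f0 : f != 0 by rewrite gt_eqF ?conf_gt0.
have a0 : A t != 0 by rewrite gt_eqF.
apply: (mulfI (mulf_neq0 f0 a0)); rewrite -mulrA E [in RHS]mxE.
by move: (sigma 0 i) => y; field.
Qed.

End TensionConformalField.

(** * Tension of the gradient field in terms of [a] and of the profiles *)

Section SphereGradient.
Context {R : realType} {n : nat}.
Variables (a : 'rV[R]_n.+1) (A B : R -> R) (s : bool) (x : 'rV[R]_n).

Let sigma := sphere_grad (fun p : 'rV[R]_n.+1 => dotv a p).
Let lam := height (axial a s) (equatorial a) x.
Let t := dotv a a - lam ^+ 2.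

Lemma as_map_grad :
  as_map (sigma s) = fun y => row_mx y (cfield (axial a s) (equatorial a) y).
Proof. by apply/funext => y; rewrite /as_map /sigma sphere_grad_cfield. Qed.

Lemma sqn_grad : sqn (row_mx x (cfield (axial a s) (equatorial a) x)) = t.
Proof. by rewrite /sqn row_mxKl row_mxKr normsq_cfield /t (dotv_coords a s). Qed.

Variables (A1 B1 : R).
Hypotheses (A_gt0 : 0 < A t) (B_gt0 : 0 < B t).
Hypotheses (dA : is_derive t 1 A A1) (dB : is_derive t 1 B B1).

Lemma tension_v_grad : tension_v sigma A B (fun=> 0) s x =
  (((2 - n%:R) * lam ^+ 2 * B1 - B t - n%:R * A1) / B t)
    *: cfield (axial a s) (equatorial a) x.
Proof.
rewrite /tension_v /sphere_tension as_map_grad vpart_sphere.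
by rewrite -sqn_grad; apply: svpart_tension; rewrite sqn_grad.
Qed.

Lemma tension_h_grad : tension_h sigma A B (fun=> 0) s x =
  (- lam * (2 * A1 + (n%:R - 1) * B t) / A t) *: cfield (axial a s) (equatorial a) x.
Proof.
rewrite /tension_h /sphere_tension as_map_grad.
by rewrite -sqn_grad; apply: lsubmx_tension; rewrite sqn_grad.
Qed.
End SphereGradient.

(** * Vanishing of the tension, a point where lambda sigma is nonzero, and the two profiles *)

Lemma tension_eq0 {R : realType} {n : nat} (sigma : bool -> 'rV[R]_n -> 'rV[R]_n)
    (A B C : R -> R) s x :
  tension_h sigma A B C s x = 0 -> tension_v sigma A B C s x = 0 ->
  sphere_tension sigma A B C s x = 0.
Proof.
rewrite /tension_v /tension_h => h0 v0.
rewrite (hv_decomp (@sphere_metric R n s) (as_map (sigma s) x) (sphere_tension _ _ _ _ _ _)).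
by rewrite h0 v0 /hlift /vlift conn0 oppr0 !row_mx0 addr0.
Qed.

(** On the sphere lambda vanishes only on the equator orthogonal to [a], and sigma only at the two
    points of the line of [a]. The witness avoiding both depends on the position of [a] relative to
    the axis of the chart. *)
Lemma exists_height_cfield_neq0 {R : realType} {n : nat} (a : 'rV[R]_n.+1) :
  (0 < n)%N -> a != 0 -> exists x : 'rV[R]_n,
    height (axial a false) (equatorial a) x != 0 /\
    cfield (axial a false) (equatorial a) x != 0.
Proof.
case: n a => // n a _ a0; set c := axial a false; set b := equatorial a.
have [b0|b0] := eqVneq b 0; last have [c0|c0] := eqVneq c 0.
- have c0 : c != 0.
    apply: contra_neq a0 => c0; apply: dotv_eq0.
    by rewrite (dotv_coords a false) -/(axial a false) -/c -/(equatorial a) -/b c0 b0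
      dotv0r expr0n addr0.
  (* With [a] on the axis, x = 0 is a zero of sigma and |x| = 1 is the zero set of lambda; norm 2
     avoids both. *)
  pose x : 'rV[R]_n.+1 := 2 *: delta_mx 0 0; exists x.
  have N5 : snorm x = 5.
    by rewrite /snorm !bidotvE dotv_delta mxE !eqxx /=; ring.
  split.
    rewrite /height N5 b0 dotv0l (_ : _ / 5 = 3 / 5 * c); last by field.
    by rewrite mulf_neq0 // mulf_neq0 ?invr_eq0 ?pnatr_eq0.
  rewrite /cfield b0 dotv0l scaler0 addr0 subr0 scaler_eq0 negb_or c0 /=.
  by apply/rV0Pn; exists 0; rewrite !mxE !eqxx /= mulr1 pnatr_eq0.
(* With [a] orthogonal to the axis, sigma vanishes where x is plus or minus b / |b|. This [r] gives
   a nonzero multiple of [b] of norm less than 1. *)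
- pose r := (1 + dotv b b)^-1; exists (r *: b).
  have bb := dotv_gt0 b b0.
  have r0 : 0 < r by rewrite invr_gt0; lra.
  split.
    rewrite /height c0 mul0r add0r dotvZr.
    by rewrite gt_eqF // divr_gt0 ?snorm_gt0 // !mulr_gt0.
  rewrite /cfield c0 sub0r dotvZr scalerA -scalerDl scaler_eq0 negb_or b0 andbT.
  have -> : - (r * dotv b b) * r + snorm (r *: b) / 2 = (1 - r ^+ 2 * dotv b b) / 2.
    by rewrite /snorm !bidotvE; field.
  rewrite mulf_neq0 ?invr_eq0 ?pnatr_eq0 // gt_eqF // subr_gt0.
  have : r * (1 + dotv b b) = 1 by rewrite mulVf //; lra.
  nra.
(* In the generic case the origin works: there lambda is [- c] and sigma is half of [b]. *)
- exists 0; have N1 : snorm (0 : 'rV[R]_n.+1) = 1 by rewrite /snorm dotv0r addr0.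
  split.
    by rewrite /height N1 dotv0r (_ : _ / 1 = - c) ?oppr_eq0 //; field.
  rewrite /cfield N1 scaler0 add0r scaler_eq0 negb_or b0 andbT.
  by rewrite mulf_neq0 ?invr_eq0 ?pnatr_eq0 // oner_eq0.
Qed.

Lemma is_derive_exp_profile {R : realType} (K t : R) :
  is_derive t 1 (fun t => K * expR (- t / 2)) (- (K * expR (- t / 2)) / 2).
Proof.
have HL : is_derive t 1 (fun t : R => - t / 2) (- 2^-1).
  rewrite (_ : (fun t => _) = (- 2^-1) \*: id); last first.
    by apply/funext => u; rewrite /= /GRing.scale /=; ring.
  by apply: is_derive_eq; rewrite /GRing.scale /= mulr1.
have HE := @is_derive1_comp _ expR _ t _ _ (is_derive_expR (- t / 2)) HL.
have HK := @is_deriveZ _ _ _ _ K _ _ _ HE.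
by apply: is_derive_eq; rewrite /GRing.scale /=; ring.
Qed.

(** The profile solves (d - k t) B' = - B: the exponent 1 / k cancels the inner derivative - k up to
    sign. With k = n - 2 and d = n + (n - 2) |a|^2, the factor d - k t is n + (n - 2) lambda^2 at t
    = |sigma|^2. *)
Lemma is_derive_powR_profile {R : realType} (K k d t : R) : k != 0 -> 0 < d - k * t ->
  is_derive t 1 (fun t => K * (d - k * t) `^ k^-1)
    (- (K * (d - k * t) `^ k^-1) / (d - k * t)).
Proof.
move=> k0 D0.
have HL : is_derive t 1 (fun t : R => d - k * t) (- k).
  rewrite (_ : (fun t => _) = cst d - k \*: id) //.
  by apply: is_derive_eq; rewrite /GRing.scale /= mulr1 sub0r.
have HE := @is_derive1_comp _ (@powR R ^~ k^-1) _ t _ _ (is_derive1_powR k^-1 D0) HL.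
have HK := @is_deriveZ _ _ _ _ K _ _ _ HE.
apply: is_derive_eq; rewrite /GRing.scale /=.
rewrite powRD ?powR_inv1 ?(ltW D0) //; last first.
  by apply/implyP => _; rewrite gt_eqF.
by field; rewrite k0 gt_eqF.
Qed.

Theorem proposition7p1 (R : realType) (n : nat) (a : 'rV[R]_n.+1) (A0 K : R)
  (ha : a != 0) (hA0 : 0 < A0) (hK : 0 < K) :
  let sigma := sphere_grad (fun p : 'rV[R]_n.+1 => dotv a p) in
  let C : R -> R := fun _ => 0 in
  (n = 2%N ->
    let B : R -> R := fun t => K * expR (- t / 2) in
    let A : R -> R := fun t => B t + A0 in
    harmonic_section sigma A B C /\ harmonic_map sigma A B C)
  /\
  ((2 < n)%N ->
    let B : R -> R := fun t =>
      K * (n%:R + (n%:R - 2) * dotv a a - (n%:R - 2) * t) `^ ((n%:R - 2)^-1) in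
    let A : R -> R := fun t => B t + A0 in
    harmonic_section sigma A B C /\ ~ harmonic_map sigma A B C).
Proof.
move=> sigma C.
have dAB (B : R -> R) (t B1 : R) : is_derive t 1 B B1 -> is_derive t 1 (fun t => B t + A0) B1.
  move=> dB; have := is_deriveD dB (is_derive_cst A0 t 1).
  by rewrite addr0.
split=> [n2 B A|n2 B A].
  have nE : n%:R = 2 :> R by rewrite n2.
  have B_gt0 t : 0 < B t by rewrite mulr_gt0 ?expR_gt0.
  have A_gt0 t : 0 < A t by rewrite addr_gt0.
  have dB (t : R) : is_derive t 1 B (- B t / 2) by exact: is_derive_exp_profile.
  have dA (t : R) : is_derive t 1 A (- B t / 2) by exact: dAB.
  have sec : harmonic_section sigma A B C.
    move=> s x; rewrite (tension_v_grad _ _ _ _ _ _ _ (A_gt0 _) (B_gt0 _) (dA _) (dB _)).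
    rewrite (_ : _ / _ = 0) ?scale0r // nE; move: (B_gt0 (dotv a a -
      height (axial a s) (equatorial a) x ^+ 2)); move: (B _) => y y0.
    by field; rewrite gt_eqF.
  split=> // s x; apply: tension_eq0; last exact: sec.
  rewrite (tension_h_grad _ _ _ _ _ _ _ (A_gt0 _) (B_gt0 _) (dA _) (dB _)).
  rewrite (_ : _ / _ = 0) ?scale0r // nE; have := A_gt0 (dotv a a -
      height (axial a s) (equatorial a) x ^+ 2).
  by move: (A _) => y y0; field; rewrite gt_eqF.
have k0 : (0 : R) < n%:R - 2 by rewrite subr_gt0 ltr_nat.
(* The base of the power in [B], evaluated at |sigma|^2. It is at least [n], so along sigma the
   profile is positive and differentiable. *)
pose D s x : R := n%:R + (n%:R - 2) * height (axial a s) (equatorial a) x ^+ 2.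
pose t s x := dotv a a - height (axial a s) (equatorial a) x ^+ 2.
have DE s x : n%:R + (n%:R - 2) * dotv a a - (n%:R - 2) * t s x = D s x.
  by rewrite /t /D; ring.
have D_ge s x : n%:R <= D s x by rewrite lerDl mulr_ge0 ?sqr_ge0 // ltW.
have n3 : (3 : R) <= n%:R by rewrite ler_nat.
have D_gt0 s x : 0 < D s x by apply: lt_le_trans (D_ge s x); lra.
have B_gt0 s x : 0 < B (t s x) by rewrite mulr_gt0 // powR_gt0 // DE.
have A_gt0 s x : 0 < A (t s x) by rewrite addr_gt0.
have dB s x : is_derive (t s x) 1 B (- B (t s x) / D s x).
  by rewrite -[D s x]DE; apply: is_derive_powR_profile; rewrite ?DE // gt_eqF.
have dA s x : is_derive (t s x) 1 A (- B (t s x) / D s x) by exact: dAB.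
split=> [s x|harm].
  rewrite (tension_v_grad _ _ _ _ _ _ _ (A_gt0 s x) (B_gt0 s x) (dA s x) (dB s x)).
  rewrite (_ : _ / _ = 0) ?scale0r //.
  apply/eqP; rewrite mulf_eq0; apply/orP; left; apply/eqP.
  rewrite -/(t s x); have := D_gt0 s x; rewrite /D => d0.
  by field; rewrite gt_eqF.
(* A single point of a single chart refutes harmonicity: the horizontal part of the tension is
   nonzero there. *)
have [x [h0 c0]] := exists_height_cfield_neq0 a (ltnW (ltnW n2)) ha.
have : tension_h sigma A B C false x = 0.
  by rewrite /tension_h harm /hpart linear0.
rewrite (tension_h_grad _ _ _ _ _ _ _ (A_gt0 _ x) (B_gt0 _ x) (dA _ x) (dB _ x)).
apply/eqP; rewrite scaler_eq0 negb_or c0 andbT mulf_neq0 ?invr_eq0 //.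
  rewrite mulf_neq0 ?oppr_eq0 // -/(t false x).
  (* Over the common denominator [D] the coefficient is visibly positive: [D] is at least [n], hence
     at least 3, so (n - 1) D exceeds 2. *)
  have -> : 2 * (- B (t false x) / D false x) + (n%:R - 1) * B (t false x) =
      B (t false x) * ((n%:R - 1) * D false x - 2) / D false x.
    by field; rewrite gt_eqF.
  rewrite gt_eqF // divr_gt0 // mulr_gt0 // subr_gt0.
  have := D_ge false x; nra.
by rewrite gt_eqF // (A_gt0 false x).
Qed.
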